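(* Let $\Theta$ be a finite set, $\mathcal N\colon\Theta\to 2^\Theta$ a symmetric neighborhood function, and $\pi$ a probability distribution on $\Theta$ with $\pi(\theta)>0$ for every $\theta\in\Theta$. Suppose there exist a function $g\colon\Theta\to\Theta$, a state $\theta^*\in\Theta$ and constants $t_1,t_2>0$, $p>1$ such that (i) $|\mathcal N(\theta)|\le p^{t_1}$ for each $\theta\in\Theta$, and (ii) $g(\theta)\in\mathcal N(\theta)$ and $\pi(g(\theta))/\pi(\theta)\ge p^{t_2}$ for each $\theta\ne\theta^*$. Let $h\colon(0,\infty)\to(0,\infty)$, let $\mathbf P^h$ be the local Metropolis–Hastings transition matrix associated with $(\Theta,\mathcal N,\pi,h)$, and let $\mathbf P^h_{\mathrm{lazy}}=(\mathbf P^h+\mathbf I)/2$. For each $\theta\ne\theta^*$ define $\mathcal N^*(\theta)=\{\theta'\in\mathcal N(\theta)\colon \pi(\theta')\ge p^{t_2}\pi(\theta)\}$, and let $\pi_{\min}=\min_{\theta\in\Theta}\pi(\theta)$. If $t_2>t_1$, then $$T_{\mathrm{mix}}(\mathbf P^h_{\mathrm{lazy}})\le \frac{2\,C(p,t_1,t_2)\,\log\left(\frac{4}{\pi_{\min}}\right)}{\min_{\theta\ne\theta^*}\mathbf P^h(\theta,\mathcal N^*(\theta))},\qquad\text{where } C(p,t_1,t_2)=\frac{1+(1-p^{t_1-t_2})^{-1}}{[1-p^{(t_1-t_2)/2}]^2}.$$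
   Context: A neighborhood function is a map $\mathcal N\colon\Theta\to2^\Theta$ with $\theta\notin\mathcal N(\theta)$; it is symmetric if $\theta\in\mathcal N(\theta')$ always implies $\theta'\in\mathcal N(\theta)$. Local Metropolis–Hastings chain: define the proposal $$\mathbf K^h(\theta,\theta')=\frac{h(\pi(\theta')/\pi(\theta))}{\sum_{\tilde\theta\in\mathcal N(\theta)}h(\pi(\tilde\theta)/\pi(\theta))}\,\mathbf 1\{\theta'\in\mathcal N(\theta)\},$$ and the transition matrix $$\mathbf P^h(\theta,\theta')=\mathbf K^h(\theta,\theta')\min\Big\{1,\frac{\pi(\theta')\mathbf K^h(\theta',\theta)}{\pi(\theta)\mathbf K^h(\theta,\theta')}\Big\}\ \text{ for }\theta'\ne\theta\ (\text{equal to }0\text{ if }\theta'\notin\mathcal N(\theta)),\qquad \mathbf P^h(\theta,\theta)=1-\sum_{\tilde\theta\ne\theta}\mathbf P^h(\theta,\tilde\theta).$$ For $A\subseteq\Theta$, $\mathbf P^h(\theta,A)=\sum_{\theta'\in A}\mathbf P^h(\theta,\theta')$. $\mathbf I$ is the identity matrix. Mixing time: for an irreducible aperiodic transition matrix $\mathbf P$ on a finite set $\Theta$ with stationary distribution $\pi$, $T_{\mathrm{mix}}(\mathbf P)=\max_{\theta\in\Theta}\min\{t\ge0\colon\|\mathbf P^t(\theta,\cdot)-\pi(\cdot)\|_{\mathrm{TV}}\le 1/4\}$, where the total variation distance takes values in $[0,1]$. *)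

(* Defs.v *)
From mathcomp Require Import all_boot all_order all_algebra.
From mathcomp Require Import all_classical all_reals all_analysis.

Set Implicit Arguments.
Unset Strict Implicit.
Unset Printing Implicit Defensive.

Import Order.TTheory GRing.Theory Num.Theory.
Local Open Scope classical_set_scope.
Local Open Scope ring_scope.

Definition neighborhood_function (T : finType) (N : T -> {set T}) : Prop :=
  forall x, x \notin N x.

Definition symmetric_neighborhood (T : finType) (N : T -> {set T}) : Prop :=
  forall x y, x \in N y -> y \in N x.

Definition positive_distribution (R : realType) (T : finType) (pi : T -> R) :
  Prop := (forall x, 0 < pi x) /\ \sum_x pi x = 1.

Definition proposal (R : realType) (T : finType) (N : T -> {set T})
    (pi : T -> R) (h : R -> R) (x y : T) : R :=
  h (pi y / pi x) / (\sum_(z in N x) h (pi z / pi x)) * (y \in N x)%:R.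

Definition mh_off_diagonal (R : realType) (T : finType) (N : T -> {set T})
    (pi : T -> R) (h : R -> R) (x y : T) : R :=
  let K := proposal N pi h in
  if y \in N x then K x y * Num.min 1 (pi y * K y x / (pi x * K x y)) else 0.

Definition local_mh (R : realType) (T : finType) (N : T -> {set T})
    (pi : T -> R) (h : R -> R) (x y : T) : R :=
  if y == x then 1 - \sum_(z | z != x) mh_off_diagonal N pi h x z
  else mh_off_diagonal N pi h x y.

Definition trans_prob (R : realType) (T : finType) (P : T -> T -> R)
  (x : T) (A : {set T}) : R := \sum_(y in A) P x y.

Definition id_matrix (R : realType) (T : finType) (x y : T) : R := (x == y)%:R.

Definition lazy (R : realType) (T : finType) (P : T -> T -> R) (x y : T) : R :=
  (P x y + id_matrix R x y) / 2.

Fixpoint trans_power (R : realType) (T : finType) (P : T -> T -> R) (t : nat)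
    (x y : T) : R :=
  if t is s.+1 then \sum_z P x z * trans_power P s z y else id_matrix R x y.

Definition tv_dist (R : realType) (T : finType) (mu nu : T -> R) : R :=
  \big[Order.max/0]_(A : {set T}) `|\sum_(x in A) mu x - \sum_(x in A) nu x|.

(* The value lies in \bar R, and the infimum of an empty set of times is +oo;
   hence a finite upper bound on [mixing_time P pi] includes the claim that the
   level 1/4 is reached from every initial state. *)
Definition mixing_time (R : realType) (T : finType) (P : T -> T -> R)
    (pi : T -> R) : \bar R :=
  \big[Order.max/-oo%E]_(x : T)
    ereal_inf [set (t%:R)%:E | t in
                [set t : nat | tv_dist (trans_power P t x) pi <= 4^-1]].

(* The default value 1 is neutral because probability masses are at most 1. *)
Definition pi_min (R : realType) (T : finType) (pi : T -> R) : R :=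
  \big[Order.min/1]_(x : T) pi x.

Definition improving_neighbors (R : realType) (T : finType)
    (N : T -> {set T}) (pi : T -> R) (p t2 : R) (x : T) : {set T} :=
  [set y in N x | p `^ t2 * pi x <= pi y].

(* If [xstar] is the only state, this is the minimum of the empty set, +oo. *)
Definition min_improving_prob (R : realType) (T : finType) (N : T -> {set T})
    (pi : T -> R) (h : R -> R) (p t2 : R) (xstar : T) : \bar R :=
  \big[Order.min/+oo%E]_(x : T | x != xstar)
    (trans_prob (local_mh N pi h) x (improving_neighbors N pi p t2 x))%:E.

Definition mixing_const (R : realType) (p t1 t2 : R) : R :=
  (1 + (1 - p `^ (t1 - t2))^-1) / (1 - p `^ ((t1 - t2) / 2)) ^+ 2.

(* Main.v *)
(* Climbing by P(x, .) conditioned on N*(x) contracts L2(pi) off x*: the states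
   x with y in N*(x) have total mass at most p^(t1-t2) pi(y).  With
   s = p^((t1-t2)/2) this yields a Poincare inequality for P with constant
   1 / (m (1-s)^2), where m is the minimum of P(x, N*(x)) over x <> x*.  Since
   Var(Lf) <= Var(f) - E(f)/2 for the lazy chain L and the Dirichlet form E of P,
   the variance of L^t 1_A decays like (1 - m (1-s)^2 / 2)^t, which bounds the
   total variation distance.  The factor 1 + (1 - p^(t1-t2))^-1 >= 2 of
   the constant C is only needed to absorb the rounding of t to an integer. *)
Require Import Defs.
From mathcomp Require Import all_boot all_order all_algebra.
From mathcomp Require Import all_classical all_reals all_analysis.
From mathcomp Require Import ring lra.

Set Implicit Arguments.
Unset Strict Implicit.
Unset Printing Implicit Defensive.

Import Order.TTheory GRing.Theory Num.Theory.
Local Open Scope ring_scope.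

(** * Variance and Dirichlet form of a reversible kernel *)

Definition reversible_chain (R : realType) (T : finType) (pi : T -> R)
    (P : T -> T -> R) : Prop :=
  [/\ forall x y, 0 <= P x y, forall x, \sum_y P x y = 1
    & forall x y, pi x * P x y = pi y * P y x].

Definition apply_kernel (R : realType) (T : finType) (P : T -> T -> R)
  (f : T -> R) (x : T) : R := \sum_y P x y * f y.

Definition mean (R : realType) (T : finType) (pi f : T -> R) : R :=
  \sum_x pi x * f x.

Definition variance (R : realType) (T : finType) (pi f : T -> R) : R :=
  \sum_x pi x * (f x - mean pi f) ^+ 2.

Definition dirichlet (R : realType) (T : finType) (pi : T -> R)
    (P : T -> T -> R) (f : T -> R) : R :=
  (\sum_x \sum_y pi x * P x y * (f x - f y) ^+ 2) / 2.

(** Bias-variance decomposition. A row [P x] in the role of [pi] gives Jensen's inequality for the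
    kernel; a well-chosen [c] gives upper bounds on the variance. *)
Lemma sum_sqrB_mean (R : realType) (T : finType) (pi f : T -> R) (c : R) :
  \sum_x pi x = 1 ->
  \sum_x pi x * (f x - c) ^+ 2 = variance pi f + (mean pi f - c) ^+ 2.
Proof.
move=> pi1; have E a : \sum_x pi x * (f x - a) ^+ 2 =
    \sum_x pi x * f x ^+ 2 - 2 * a * mean pi f + a ^+ 2.
  have -> : a ^+ 2 = a ^+ 2 * \sum_x pi x by rewrite pi1 mulr1.
  rewrite /mean !mulr_sumr -sumrB -big_split /=.
  by apply: eq_bigr => x _; ring.
by rewrite /variance !E; ring.
Qed.

Lemma stationary (R : realType) (T : finType) (pi : T -> R) (P : T -> T -> R) y :
  reversible_chain pi P -> \sum_x pi x * P x y = pi y.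
Proof.
move=> [_ P1 rev]; rewrite (eq_bigr (fun x => pi y * P y x)) => [|x _].
  by rewrite -mulr_sumr P1 mulr1.
by rewrite rev.
Qed.

Lemma mean_apply_kernel (R : realType) (T : finType) (pi : T -> R)
    (P : T -> T -> R) (f : T -> R) :
  reversible_chain pi P -> mean pi (apply_kernel P f) = mean pi f.
Proof.
move=> rP; rewrite /mean /apply_kernel.
under eq_bigr do rewrite mulr_sumr.
rewrite exchange_big /=; apply: eq_bigr => y _.
rewrite -(stationary y rP) mulr_suml.
by apply: eq_bigr => x _; rewrite mulrA.
Qed.

Lemma sqr_apply_kernel_le (R : realType) (T : finType) (P : T -> T -> R)
    (f : T -> R) x :
  (forall y, 0 <= P x y) -> \sum_y P x y = 1 ->
  apply_kernel P f x ^+ 2 <= apply_kernel P (fun y => f y ^+ 2) x.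
Proof.
move=> P0 P1.
have := sum_sqrB_mean f 0 P1; rewrite subr0.
under eq_bigr do rewrite subr0.
rewrite /apply_kernel => ->; rewrite lerDr.
by apply: sumr_ge0 => y _; rewrite mulr_ge0 ?sqr_ge0.
Qed.

(** After expanding the square, the terms in [f x ^+ 2] and [f y ^+ 2] contribute equally, because
    [pi] is stationary. *)
Lemma dirichletE (R : realType) (T : finType) (pi : T -> R) (P : T -> T -> R)
    (f : T -> R) : reversible_chain pi P ->
  dirichlet pi P f =
    \sum_x pi x * f x ^+ 2 - \sum_x pi x * (f x * apply_kernel P f x).
Proof.
move=> rP; rewrite /dirichlet.
have -> : \sum_x \sum_y pi x * P x y * (f x - f y) ^+ 2 =
   \sum_x pi x * f x ^+ 2 + mean pi (apply_kernel P (fun y => f y ^+ 2))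
   - 2 * \sum_x pi x * (f x * apply_kernel P f x).
  rewrite /mean -big_split /= mulr_sumr -sumrB; apply: eq_bigr => x _.
  have [_ P1 _] := rP.
  have -> : pi x * f x ^+ 2 = pi x * f x ^+ 2 * \sum_y P x y.
    by rewrite P1 mulr1.
  rewrite /apply_kernel !mulr_sumr -big_split -sumrB.
  by apply: eq_bigr => y _ /=; ring.
by rewrite mean_apply_kernel // /mean; field.
Qed.

Lemma apply_lazy (R : realType) (T : finType) (P : T -> T -> R) (f : T -> R) x :
  apply_kernel (lazy P) f x = (apply_kernel P f x + f x) / 2.
Proof.
have -> : apply_kernel P f x + f x =
    apply_kernel P f x + \sum_y id_matrix R x y * f y.
  congr (_ + _).
  rewrite (bigD1 x) //= big1 => [|y yx]; rewrite /id_matrix.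
    by rewrite eqxx mul1r addr0.
  by rewrite eq_sym (negPf yx) mul0r.
rewrite /apply_kernel -big_split mulr_suml; apply: eq_bigr => y _ /=.
by rewrite /lazy; ring.
Qed.

(** For centred F, the square of the L2(pi)-norm of (F + PF)/2 is (|F|^2 + 2<F,PF> + |PF|^2)/4.
    Since |PF| <= |F|, this is at most (|F|^2 + <F,PF>)/2 = |F|^2 - E(F)/2. Laziness thus replaces
    any control of negative eigenvalues. *)
Lemma variance_lazy_le (R : realType) (T : finType) (pi : T -> R)
    (P : T -> T -> R) (f : T -> R) :
  positive_distribution pi -> reversible_chain pi P ->
  variance pi (apply_kernel (lazy P) f) <= variance pi f - dirichlet pi P f / 2.
Proof.
move=> [pi0 pi1] rP; have [P0 P1 _] := rP.
set c := mean pi f; pose F x := f x - c.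
have PF x : apply_kernel P F x = apply_kernel P f x - c.
  rewrite -[c in RHS]mulr1 -(P1 x) /apply_kernel mulr_sumr -sumrB.
  by apply: eq_bigr => y _; rewrite /F; ring.
have mL : mean pi (apply_kernel (lazy P) f) = c.
  rewrite /mean; under eq_bigr do rewrite apply_lazy mulrA mulrDr.
  rewrite -mulr_suml big_split /= -/(mean _ _) mean_apply_kernel // -/(mean _ _).
  by rewrite -/c; field.
have dF : dirichlet pi P f = dirichlet pi P F.
  rewrite /dirichlet; congr (_ / 2); apply: eq_bigr => x _.
  by apply: eq_bigr => y _; rewrite /F; ring.
rewrite dF dirichletE // /variance mL -/c.
(* One copy of the second moment of [F] is traded, by stationarity, for the mean of [P] applied to
   F^2, so that the two sides can be compared pointwise in [x]. *)
have -> : \sum_x pi x * (f x - c) ^+ 2 -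
   (\sum_x pi x * F x ^+ 2 - \sum_x pi x * (F x * apply_kernel P F x)) / 2 =
   (\sum_x pi x * F x ^+ 2 + 2 * \sum_x pi x * (F x * apply_kernel P F x)
    + mean pi (apply_kernel P (fun y => F y ^+ 2))) / 4.
  by rewrite mean_apply_kernel // /mean /F; field.
rewrite /mean mulr_sumr -!big_split /= mulr_suml; apply: ler_sum => x _.
have := sqr_apply_kernel_le F (P0 x) (P1 x).
rewrite apply_lazy.
have -> : apply_kernel P f x = apply_kernel P F x + c by rewrite PF subrK.
have -> : f x = F x + c by rewrite subrK.
move=> /(ler_wpM2l (ltW (pi0 x))) => H; lra.
Qed.

(** * Poincare inequality from climbing *)

(* Writing F = f - f x0, the value F x is the average of (F x - F y) + F y over
   a random y in W x.  The first part is controlled by the Dirichlet form, and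
   F y, as a function of x, has L2(pi)-norm at most s times that of F. *)
Lemma poincare_climbing (R : realType) (T : finType) (pi : T -> R)
    (P : T -> T -> R) (W : T -> {set T}) (x0 : T) (m s : R) (f : T -> R) :
  positive_distribution pi -> reversible_chain pi P ->
  0 < m -> 0 < s -> s < 1 ->
  (forall x, x != x0 -> m <= trans_prob P x (W x)) ->
  (forall x y, y \in W x -> x \notin W y) ->
  (forall y, \sum_(x | y \in W x) pi x <= s ^+ 2 * pi y) ->
  m * (1 - s) ^+ 2 * variance pi f <= dirichlet pi P f.
Proof.
move=> [pi0 pi1] [P0 P1 rev] m0 s0 s1 mW asymW sumW.
pose F x := f x - f x0.
pose A x := \sum_(y in W x) P x y * (f x - f y) ^+ 2.
pose B x := \sum_(y in W x) F y ^+ 2.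
have A0 x : 0 <= A x by apply: sumr_ge0 => y _; rewrite mulr_ge0 ?sqr_ge0.
have B0 x : 0 <= B x by apply: sumr_ge0 => y _; rewrite sqr_ge0.
have step x : m * (s * (1 - s) * F x ^+ 2 - (1 - s) * B x) <= s * A x.
  have [->|xx0] := eqVneq x x0.
    rewrite /F subrr expr0n mulr0 sub0r mulrN.
    apply: (@le_trans _ _ 0); last by rewrite mulr_ge0 // ltW.
    by rewrite oppr_le0 !mulr_ge0 // ?subr_ge0 ltW.
  (* When [D] is positive, [m] may be replaced by the larger climbing probability at [x]; otherwise
     the left side is nonpositive. *)
  set D := _ - _ * B x.
  have [D0|D0] := lerP D 0.
    apply: (@le_trans _ _ 0); last by rewrite mulr_ge0 // ltW.
    by rewrite mulr_ge0_le0 // ltW.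
  apply: (@le_trans _ _ (trans_prob P x (W x) * D)).
    by rewrite ler_wpM2r ?mW // ltW.
  suff H : trans_prob P x (W x) * (s * (1 - s) * F x ^+ 2) <=
      s * A x + (1 - s) * \sum_(y in W x) P x y * F y ^+ 2.
    have H' : \sum_(y in W x) P x y * F y ^+ 2 <= trans_prob P x (W x) * B x.
      rewrite mulr_sumr; apply: ler_sum => y yW.
      rewrite ler_wpM2r ?sqr_ge0 // /trans_prob (bigD1 y) //= lerDl.
      exact: sumr_ge0.
    have := ler_wpM2l _ H' => /(_ (1 - s)).
    rewrite subr_ge0 ltW // => /(_ isT) H1; rewrite /D; lra.
  rewrite /trans_prob /A mulr_suml !mulr_sumr -big_split /=.
  apply: ler_sum => y _; rewrite -subr_ge0.
  (* With a = f x - f y and b = F y, so that F x = a + b, the gap in the weighted inequality s (1-s)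
     (a+b)^2 <= s a^2 + (1-s) b^2 is a perfect square. *)
  have -> : s * (P x y * (f x - f y) ^+ 2) + (1 - s) * (P x y * F y ^+ 2) -
     P x y * (s * (1 - s) * F x ^+ 2) =
     P x y * (s * (f x - f y) - (1 - s) * F y) ^+ 2 by rewrite /F; ring.
  by rewrite mulr_ge0 // sqr_ge0.
pose S := \sum_x pi x * F x ^+ 2.
(* By asymmetry of [W], the left side counts each unordered pair at most once, while the double sum
   in [dirichlet] counts it twice before halving. *)
have AE : \sum_x pi x * A x <= dirichlet pi P f.
  pose G x y := pi x * P x y * (f x - f y) ^+ 2.
  have G0 x y : 0 <= G x y by rewrite mulr_ge0 ?sqr_ge0 // mulr_ge0 // ltW.
  have GC x y : G x y = G y x by rewrite /G rev -[f y - _]opprB sqrrN.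
  have -> : \sum_x pi x * A x = \sum_x \sum_y (y \in W x)%:R * G x y.
    apply: eq_bigr => x _; rewrite /A mulr_sumr big_mkcond /=.
    by apply: eq_bigr => y _; case: ifP => _; rewrite ?mul1r ?mul0r // mulrA.
  rewrite /dirichlet ler_pdivlMr // mulrDr mulr1.
  rewrite [X in _ + X]exchange_big -big_split /=; apply: ler_sum => x _.
  rewrite -big_split /=; apply: ler_sum => y _.
  rewrite [G y x]GC -mulrDl -/(G x y) ler_piMl //.
  have [/asymW/negPf->|_] := boolP (y \in W x); first by rewrite addr0.
  by rewrite add0r lern1 leq_b1.
have BE : \sum_x pi x * B x <= s ^+ 2 * S.
  have -> : \sum_x pi x * B x = \sum_y (\sum_(x | y \in W x) pi x) * F y ^+ 2.
    under eq_bigr do rewrite mulr_sumr.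
    rewrite (exchange_big_dep xpredT) //=.
    by apply: eq_bigr => y _; rewrite mulr_suml.
  rewrite mulr_sumr; apply: ler_sum => y _.
  by rewrite mulrA ler_wpM2r ?sqr_ge0.
(* Averaging [step] and inserting [BE] leaves m (1-s) (s - s^2) S = m s (1-s)^2 S on the left, and
   the factor s cancels. *)
have SE : m * (1 - s) ^+ 2 * S <= dirichlet pi P f.
  have : \sum_x pi x * (m * (s * (1 - s) * F x ^+ 2 - (1 - s) * B x)) <=
         \sum_x pi x * (s * A x).
    by apply: ler_sum => x _; rewrite ler_wpM2l // ltW.
  have -> : \sum_x pi x * (s * A x) = s * \sum_x pi x * A x.
    by rewrite mulr_sumr; apply: eq_bigr => x _; ring.
  have -> : \sum_x pi x * (m * (s * (1 - s) * F x ^+ 2 - (1 - s) * B x)) =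
      m * (1 - s) * s * S - m * (1 - s) * \sum_x pi x * B x.
    rewrite /S !mulr_sumr -sumrB; apply: eq_bigr => x _; ring.
  have k0 : 0 <= m * (1 - s) by rewrite mulr_ge0 ?subr_ge0 // ltW.
  move: (ler_wpM2l k0 BE) (ler_wpM2l (ltW s0) AE) => H1 H2 H3.
  rewrite -(ler_pM2l s0).
  have -> : s * (m * (1 - s) ^+ 2 * S) =
     m * (1 - s) * s * S - m * (1 - s) * (s ^+ 2 * S) by ring.
  lra.
apply: le_trans SE; rewrite ler_wpM2l //.
  by rewrite mulr_ge0 ?sqr_ge0 // ltW.
by rewrite [S](sum_sqrB_mean f (f x0) pi1) lerDl sqr_ge0.
Qed.

(** * From variance decay to total variation *)

Definition indicator (R : realType) (T : finType) (A : {set T}) (x : T) : R :=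
  (x \in A)%:R.

Lemma sum_indicator (R : realType) (T : finType) (mu : T -> R) (A : {set T}) :
  \sum_x mu x * indicator R A x = \sum_(x in A) mu x.
Proof.
rewrite [RHS]big_mkcond; apply: eq_bigr => x _ /=.
by rewrite /indicator; case: ifP; rewrite ?mulr1 ?mulr0.
Qed.

Lemma trans_power_indicator (R : realType) (T : finType) (P : T -> T -> R)
    (A : {set T}) t x :
  \sum_(y in A) trans_power P t x y =
  iter t (apply_kernel P) (indicator R A) x.
Proof.
elim: t x => [|t IH] x /=.
  rewrite -sum_indicator (bigD1 x) //= big1 => [|y yx]; rewrite /id_matrix.
    by rewrite eqxx mul1r addr0.
  by rewrite eq_sym (negPf yx) mul0r.
rewrite exchange_big /=; apply: eq_bigr => z _.
by rewrite -mulr_sumr IH.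
Qed.

(** An indicator is at distance exactly 1/2 from the constant 1/2, and the second moment about any
    constant dominates the variance. *)
Lemma variance_indicator_le (R : realType) (T : finType) (pi : T -> R)
    (A : {set T}) :
  \sum_x pi x = 1 -> variance pi (indicator R A) <= 4^-1.
Proof.
move=> pi1; have := sum_sqrB_mean (indicator R A) 2^-1 pi1.
have -> : \sum_x pi x * (indicator R A x - 2^-1) ^+ 2 = 4^-1.
  have -> : 4^-1 = 4^-1 * \sum_x pi x by rewrite pi1 mulr1.
  rewrite mulr_sumr; apply: eq_bigr => x _.
  by rewrite /indicator; case: (x \in A); rewrite ?mulr1n ?mulr0n; field.
by move->; rewrite lerDl sqr_ge0.
Qed.

Lemma pi_min_gt0 (R : realType) (T : finType) (pi : T -> R) :
  (forall x, 0 < pi x) -> 0 < pi_min pi.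
Proof. by move=> pi0; apply: lt_bigmin. Qed.

(** For an event A, P^t(x,A) - pi(A) is the deviation at [x] of u = P^t 1_A from its mean. Its
    square times [pi x] is one term of Var(u), which is at most (1 - gam)^t / 4, hence at most
    [pi_min pi / 16]; dividing by [pi x] leaves (1/4)^2. *)
Lemma tv_trans_power_le (R : realType) (T : finType) (pi : T -> R)
    (P : T -> T -> R) (gam : R) t x :
  positive_distribution pi -> reversible_chain pi P -> gam <= 1 ->
  (forall f, variance pi (apply_kernel P f) <= (1 - gam) * variance pi f) ->
  (1 - gam) ^+ t <= pi_min pi / 4 ->
  tv_dist (trans_power P t x) pi <= 4^-1.
Proof.
move=> [pi0 pi1] rP gam1 contr ht.
have q0 : 0 <= 1 - gam by rewrite subr_ge0.
apply: bigmax_le => [|A _]; first by rewrite invr_ge0.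
set u := iter t (apply_kernel P) (indicator R A).
have mu : mean pi u = \sum_(y in A) pi y.
  rewrite -sum_indicator /u; elim: t {ht u} => [|t IH] //=.
  by rewrite mean_apply_kernel.
have vu : variance pi u <= (1 - gam) ^+ t * 4^-1.
  rewrite /u; elim: t {ht u mu} => [|t IH] /=.
    by rewrite mul1r variance_indicator_le.
  apply: le_trans (contr _) _; rewrite exprS -mulrA; exact: ler_wpM2l.
rewrite trans_power_indicator -/u -mu.
rewrite -(@ler_pXn2r _ 2) ?nnegrE ?invr_ge0 // real_normK ?num_real //.
rewrite -(ler_pM2l (pi0 x)).
apply: le_trans (_ : variance pi u <= _).
  rewrite /variance (bigD1 x) //= lerDl; apply: sumr_ge0 => y _.
  by rewrite mulr_ge0 ?sqr_ge0 // ltW.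
apply: le_trans vu _; have := bigmin_le 1 x pi; rewrite -/(pi_min pi) => h.
lra.
Qed.

(** * Lazy and local Metropolis-Hastings chains, climbing sets *)

Lemma reversible_lazy (R : realType) (T : finType) (pi : T -> R)
    (P : T -> T -> R) :
  reversible_chain pi P -> reversible_chain pi (lazy P).
Proof.
move=> [P0 P1 rev]; split=> [x y|x|x y]; rewrite /lazy.
- by rewrite divr_ge0 // addr_ge0 // /id_matrix ler0n.
- have := apply_lazy P (fun=> 1) x; rewrite /apply_kernel.
  under eq_bigr do rewrite mulr1.
  move->; under eq_bigr do rewrite mulr1.
  by rewrite P1; field.
- rewrite !mulrA !mulrDr rev /id_matrix eq_sym.
  by case: eqVneq => [->|_]; rewrite ?mulr0.
Qed.

Lemma reversible_local_mh (R : realType) (T : finType) (N : T -> {set T})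
    (pi : T -> R) (h : R -> R) :
  neighborhood_function N -> symmetric_neighborhood N ->
  (forall x, 0 < pi x) -> (forall u, 0 < u -> 0 < h u) ->
  reversible_chain pi (local_mh N pi h) /\
  (forall x y, y \in N x -> 0 < local_mh N pi h x y).
Proof.
move=> Nirr Nsym pi0 h0.
pose K := proposal N pi h.
have hpos x y : 0 < h (pi y / pi x) by rewrite h0 // divr_gt0.
have K0 x y : 0 <= K x y.
  by rewrite /K /proposal mulr_ge0 // divr_ge0 ?sumr_ge0 // => *; rewrite ltW.
have Kgt0 x y : y \in N x -> 0 < K x y.
  move=> yN; rewrite /K /proposal yN mulr1 divr_gt0 // (bigD1 y) //=.
  by rewrite ltr_wpDr // sumr_ge0 // => *; rewrite ltW.
have K1 x : \sum_y K x y <= 1.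
  rewrite /K /proposal; set S := \sum_(z in N x) _.
  have -> : \sum_y h (pi y / pi x) / S * (y \in N x)%:R = S / S.
    rewrite (sum_indicator (fun y => h (pi y / pi x) / S) (N x)).
    by rewrite -mulr_suml.
  (* An empty [N x] makes the normalizer 0, and the row of [K] then sums to 0 instead of 1. *)
  by have [->|S0] := eqVneq S 0; rewrite ?mul0r ?divff.
pose O := mh_off_diagonal N pi h.
have O0 x y : 0 <= O x y.
  rewrite /O /mh_off_diagonal -/K; case: ifP => // _.
  rewrite mulr_ge0 // le_min ler01 divr_ge0 // mulr_ge0 //; exact: ltW.
have OK x y : O x y <= K x y.
  rewrite /O /mh_off_diagonal -/K; case: ifP => [_|_]; last exact: K0.
  by rewrite ler_piMr // ge_min lexx.
have Opos x y : y \in N x -> 0 < O x y.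
  move=> yN; rewrite /O /mh_off_diagonal -/K yN.
  have Kxy := Kgt0 _ _ yN; have Kyx := Kgt0 _ _ (Nsym _ _ yN).
  by rewrite mulr_gt0 // lt_min ltr01 divr_gt0 // mulr_gt0.
(* The acceptance ratio turns the flow from x to y into the smaller of the two proposal flows, which
   is symmetric. *)
have OE x y : y \in N x -> pi x * O x y = Num.min (pi x * K x y) (pi y * K y x).
  move=> yN; rewrite /O /mh_off_diagonal -/K yN.
  have Kxy : 0 < pi x * K x y by rewrite mulr_gt0 ?Kgt0.
  rewrite mulrA minr_pMr ?(ltW Kxy) // mulr1.
  by rewrite [X in Num.min _ X]mulrC divfK // gt_eqF.
have Orev x y : pi x * O x y = pi y * O y x.
  have [yN|yN] := boolP (y \in N x).
    by rewrite !OE ?(Nsym _ _ yN) // minC.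
  rewrite /O /mh_off_diagonal (negPf yN) ifF ?mulr0 //.
  by apply: contraNF yN; apply: Nsym.
have Oout x : \sum_(z | z != x) O x z <= 1.
  apply: le_trans (K1 x); rewrite [leRHS](bigD1 x) //=.
  by apply: ler_wpDl => //; apply: ler_sum.
split; last first.
  move=> x y yN; rewrite /local_mh ifF ?Opos //.
  by apply: contraTF yN => /eqP->.
split=> [x y|x|x y]; rewrite /local_mh.
- by case: ifP => // _; rewrite subr_ge0.
- rewrite (bigD1 x) //= eqxx.
  under [X in _ + X]eq_bigr => y /negPf yx do rewrite yx.
  by rewrite subrK.
- by rewrite eq_sym; case: eqVneq => [->|_] //; exact: Orev.
Qed.

(** By symmetry, every x that climbs to y is one of the at most p^t1 neighbors of y, and its mass is
    at most p^(-t2) pi(y). The square matches the parameter s of [poincare_climbing]. *)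
Lemma sum_climbing_le (R : realType) (T : finType) (N : T -> {set T})
    (pi : T -> R) (p t1 t2 : R) y :
  symmetric_neighborhood N -> (forall x, 0 < pi x) -> 0 < p ->
  #|N y|%:R <= p `^ t1 ->
  \sum_(x | y \in improving_neighbors N pi p t2 x) pi x <=
    (p `^ ((t1 - t2) / 2)) ^+ 2 * pi y.
Proof.
move=> Nsym pi0 p0 Ny.
have -> : (p `^ ((t1 - t2) / 2)) ^+ 2 = p `^ t1 / p `^ t2.
  rewrite -powR_mulrn ?powR_ge0 // -powRrM divfK ?pnatr_eq0 // powRB //.
  by rewrite (gt_eqF p0) implybT.
have pt : 0 < p `^ t2 by rewrite powR_gt0.
apply: (@le_trans _ _ (\sum_(x in N y) pi y / p `^ t2)).
  rewrite [leRHS]big_mkcond [leLHS]big_mkcond /=; apply: ler_sum => x _.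
  rewrite inE; case: ifP => [/andP[yN pxy]|_].
    by rewrite (Nsym _ _ yN) ler_pdivlMr // mulrC.
  by case: ifP => // _; rewrite divr_ge0 // ltW.
rewrite sumr_const -mulr_natl [leRHS]mulrAC -[leRHS]mulrA.
by rewrite ler_wpM2r // divr_ge0 // ltW.
Qed.

Lemma min_improving_prob_attained (R : realType) (T : finType)
    (N : T -> {set T}) (pi : T -> R) (h : R -> R) (p t2 : R) (x0 x1 : T) :
  x1 != x0 -> exists2 x, x != x0 & min_improving_prob N pi h p t2 x0 =
    (trans_prob (local_mh N pi h) x (improving_neighbors N pi p t2 x))%:E.
Proof.
move=> x10; rewrite /min_improving_prob.
have [|x xx0 ->] := @eq_bigmin _ _ _ +oo%E x1 (fun x => x != x0) (fun x =>
  (trans_prob (local_mh N pi h) x (improving_neighbors N pi p t2 x))%:E) x10.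
  by move=> x _; rewrite leey.
by exists x.
Qed.

(** * From the contraction rate to the mixing time *)

Lemma exists_contraction_time (R : realType) (q gam : R) :
  0 < q -> q <= 1 -> 0 < gam -> gam <= 2^-1 ->
  exists2 t : nat, (1 - gam) ^+ t <= q / 4 & t%:R <= 2 * ln (4 / q) / gam.
Proof.
move=> q0 q1 g0 g1; set l := ln (4 / q).
have q40 : 0 < q / 4 by rewrite divr_gt0.
have lE : l = - ln (q / 4) by rewrite -lnV ?posrE // invf_div.
have l0 : 2^-1 <= l.
  have : ln (q / 4) <= q / 4 - 1.
    by rewrite -{1}[q / 4](subrK 1) [_ - 1 + 1]addrC le_ln1Dx //; lra.
  rewrite lE; lra.
have lg : 1 <= l / gam by rewrite ler_pdivlMr // mul1r; lra.
(* This t exceeds l / gam, so (1 - gam)^t <= exp(- gam t) <= exp(- l) = q / 4. As [lg] gives l / gam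
   >= 1, the successor costs at most a factor 2. *)
exists (Num.truncn (l / gam)).+1.
  apply: (@le_trans _ _ (expR (- l))); last first.
    by rewrite lE opprK lnK.
  apply: (@le_trans _ _ (expR (- gam) ^+ (Num.truncn (l / gam)).+1)).
    rewrite lerXn2r ?nnegrE ?expR_ge0 ?expR_ge1Dx //; lra.
  rewrite -expRM_natl ler_expR mulrN lerN2 -ler_pdivrMr //.
  exact/ltW/truncnS_gt.
have : (Num.truncn (l / gam))%:R <= l / gam by rewrite truncn_le; lra.
by rewrite -natr1 -mulrA; lra.
Qed.

Theorem theorem2 (R : realType) (T : finType) (N : T -> {set T}) (pi : T -> R)
    (g : T -> T) (xstar : T) (t1 t2 p : R) (h : R -> R)
    (N_irr : neighborhood_function N) (N_sym : symmetric_neighborhood N)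
    (pi_distr : positive_distribution pi)
    (t1_gt0 : 0 < t1) (t2_gt0 : 0 < t2) (p_gt1 : 1 < p)
    (N_card : forall x, #|N x|%:R <= p `^ t1)
    (g_N : forall x, x != xstar -> g x \in N x)
    (g_pi : forall x, x != xstar -> p `^ t2 <= pi (g x) / pi x)
    (h_gt0 : forall u, 0 < u -> 0 < h u)
    (t1_lt_t2 : t1 < t2) :
  (mixing_time (lazy (local_mh N pi h)) pi <=
   (2 * mixing_const p t1 t2 * ln (4 / pi_min pi))%:E
     / min_improving_prob N pi h p t2 xstar)%E.
Proof.
have [pi0 pi1] := pi_distr.
have [rP Ppos] := reversible_local_mh N_irr N_sym pi0 h_gt0.
set P := local_mh N pi h in rP Ppos *.
have p0 : 0 < p by apply: lt_trans p_gt1.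
have [/existsP[x1 x1s]|/existsPn all_xs] := boolP [exists x, x != xstar];
    last first.
  (* With a single state the minimum is [+oo] and the bound is 0, so time 0 itself must do: the
     identity row already equals [pi]. *)
  have xs x : x = xstar by apply/eqP; rewrite -[_ == _]negbK all_xs.
  rewrite /min_improving_prob big_pred0 => [|x]; last by rewrite (xs x) eqxx.
  rewrite invey mule0; apply: bigmax_le => [|x _]; first by rewrite leNye.
  apply: ereal_inf_lbound; exists 0%N => //=.
  apply: bigmax_le => [|A _]; first by rewrite invr_ge0.
  rewrite (eq_bigr pi) ?subrr ?normr0 ?invr_ge0 // => y _ /=.
  rewrite /id_matrix (xs x) (xs y) eqxx -pi1 (bigD1 xstar) //= big1 ?addr0 //.
  by move=> z; rewrite (xs z) eqxx.
set W := improving_neighbors N pi p t2.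
have [x2 x2s mE] := min_improving_prob_attained N pi h p t2 x1s.
rewrite mE; rewrite -/P -/W in mE *.
set m := trans_prob P x2 (W x2) in mE *.
have [P0 P1 _] := rP.
(* The state [g x2] lies in [W x2] and is reached with positive probability. *)
have m0 : 0 < m.
  rewrite /m /trans_prob (bigD1 (g x2)) /=; last first.
    by rewrite inE g_N //= -ler_pdivlMr // g_pi.
  by rewrite ltr_wpDr ?Ppos ?g_N // sumr_ge0.
have m1 : m <= 1.
  rewrite -(P1 x2) /m /trans_prob [leLHS]big_mkcond.
  by apply: ler_sum => y _; case: ifP.
have mW x : x != xstar -> m <= trans_prob P x (W x).
  by move=> xs; rewrite -lee_fin -mE bigmin_le_cond.
have pow_lt1 a : a < 0 -> p `^ a < 1.
  move=> a0; rewrite /powR gt_eqF // expR_lt1 nmulr_rlt0 //.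
  exact: ln_gt0.
have b0 : 0 < p `^ (t1 - t2) by rewrite powR_gt0.
have b1 : p `^ (t1 - t2) < 1 by apply: pow_lt1; rewrite subr_lt0.
set s := p `^ ((t1 - t2) / 2).
have s0 : 0 < s by rewrite powR_gt0.
have s1 : s < 1 by apply: pow_lt1; rewrite pmulr_llt0 // subr_lt0.
have pt2 : 1 < p `^ t2.
  by rewrite /powR gt_eqF // expR_gt1 mulr_gt0 // ln_gt0.
(* Strict growth of [pi] along climbs makes [W] asymmetric, as the Poincare inequality requires. *)
have W_gt x y : y \in W x -> pi x < pi y.
  by rewrite inE => /andP[_]; apply: lt_le_trans; rewrite ltr_pMl.
(* Half the Poincare constant: the lazy chain loses only E(f)/2 of variance per step. *)
pose gam := m * (1 - s) ^+ 2 / 2.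
have k0 : 0 < (1 - s) ^+ 2 by rewrite exprn_gt0 // subr_gt0.
have gam0 : 0 < gam by rewrite divr_gt0 // mulr_gt0.
have gam1 : gam <= 2^-1.
  rewrite ler_piMl // mulr_ile1 ?(ltW m0) ?(ltW k0) //.
  by rewrite exprn_ile1 ?subr_ge0 ?(ltW s1) // lerBlDr lerDl ltW.
have contr f :
    variance pi (apply_kernel (lazy P) f) <= (1 - gam) * variance pi f.
  apply: le_trans (variance_lazy_le f pi_distr rP) _.
  have : m * (1 - s) ^+ 2 * variance pi f <= dirichlet pi P f.
    apply: (poincare_climbing (W := W) (x0 := xstar)) => // [x y yW|y].
      by apply/negP => /W_gt; rewrite ltNge (ltW (W_gt _ _ yW)).
    exact: sum_climbing_le.
  by rewrite /gam; lra.
have pmin0 := pi_min_gt0 pi0.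
have pmin1 : pi_min pi <= 1 by apply: bigmin_le_id.
have [t ht tle] := exists_contraction_time pmin0 pmin1 gam0 gam1.
have l0 : 0 <= ln (4 / pi_min pi).
  by rewrite ln_ge0 // ler_pdivlMr // mul1r; lra.
have -> : ((2 * mixing_const p t1 t2 * ln (4 / pi_min pi))%:E / m%:E =
    (2 * mixing_const p t1 t2 * ln (4 / pi_min pi) / m)%:E)%E.
  by rewrite inver gt_eqF.
(* The right side equals (1 + (1 - p^(t1-t2))^-1) l / gam with l = ln (4 / pi_min), and the first
   factor is at least 2. *)
have bound : t%:R <= 2 * mixing_const p t1 t2 * ln (4 / pi_min pi) / m.
  apply: le_trans tle _.
  have -> : 2 * mixing_const p t1 t2 * ln (4 / pi_min pi) / m =
      (1 + (1 - p `^ (t1 - t2))^-1) * ln (4 / pi_min pi) / gam.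
    by rewrite /mixing_const -/s /gam; field; rewrite !gt_eqF ?subr_gt0.
  rewrite ler_wpM2r ?invr_ge0 ?(ltW gam0) // ler_wpM2r //.
  by rewrite -lerBlDl [X in X <= _](_ : _ = 1); [rewrite invf_ge1; lra | lra].
apply: bigmax_le => [|x _]; first by rewrite leNye.
apply: (@le_trans _ _ (t%:R)%:E); last by rewrite lee_fin.
apply: ereal_inf_lbound; exists t => //=.
apply: tv_trans_power_le contr ht => //; last by lra.
exact: reversible_lazy.
Qed.
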